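(* Let $m$ and $n$ be positive integers. Then both the longest snake path and the longest snake cycle in the knight graph of size $m \times n$ are of length $mn/2 + \mathcal{O}(m + n)$.
   Context: A cell is a point of $\mathbb{Z}^2$. The knight graph of size $m \times n$ has vertex set $[0;n-1] \times [0;m-1]$, two cells $(x',y'),(x'',y'')$ being adjacent iff $\{|x'-x''|,|y'-y''|\} = \{1,2\}$. A snake path (resp. snake cycle) in a graph $G$ is a path (resp. cycle) in $G$ which is an induced subgraph of $G$. Length is the number of edges. The $\mathcal{O}$-term bounds the absolute value of the difference, with an absolute implied constant. *)

(* Defs.v *)
From HB Require Import structures.
From mathcomp Require Import all_boot all_order all_algebra.
Set Implicit Arguments.
Unset Strict Implicit.
Unset Printing Implicit Defensive.

Section Snakes.
Variables (T : finType) (e : rel T).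
Implicit Type s : seq T.

Definition path_edge s : rel T :=
  [rel x y | infix [:: x; y] s || infix [:: y; x] s].

Definition cycle_edge s : rel T :=
  [rel x y | (next s x == y) || (next s y == x)].

(* Every edge of the ambient graph between two vertices of [s] belongs to the
   edge relation [E] of the subgraph carried by [s]. *)
Definition induced s (E : rel T) : bool :=
  [forall x in s, forall y in s, e x y ==> E x y].

(* A path has at least one vertex. *)
Definition snake_path s : bool :=
  [&& s != [::], sorted e s, uniq s & induced s (path_edge s)].

Definition snake_cycle s : bool :=
  [&& 3 <= size s, ucycleb e s & induced s (cycle_edge s)].

(* Lengths count edges: k.-1 for a path on k vertices, k for a cycle on k
   vertices. As vertices do not repeat, k <= #|T|. The maximum over an empty
   family is 0; this matters only for graphs without any snake cycle (or
   without any vertex). *)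
Definition longest_snake_path : nat :=
  \max_(k < #|T|.+1 | [exists s : k.-tuple T, snake_path s]) k.-1.

Definition longest_snake_cycle : nat :=
  \max_(k < #|T|.+1 | [exists s : k.-tuple T, snake_cycle s]) k.

End Snakes.

Definition cell (m n : nat) : finType := ('I_n * 'I_m)%type.

Definition knight (m n : nat) : rel (cell m n) := fun u v =>
  let dx : int := `|Posz u.1 - Posz v.1|%R in
  let dy : int := `|Posz u.2 - Posz v.2|%R in
  (dx == 1%R) && (dy == 2%R) || (dx == 2%R) && (dy == 1%R).

(* Main.v *)
Require Import Defs.
From mathcomp Require Import all_boot all_order all_algebra zify lra.
Set Implicit Arguments.
Unset Strict Implicit.
Unset Printing Implicit Defensive.
Import Order.TTheory GRing.Theory Num.Theory.

(* Upper bound. The subset sums of the four moves (1,2), (2,1), (2,-1), (1,-2)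
   form a 4-cube in the knight graph. Huang's signing A of the 4-cube satisfies
   A^2 = 4, so 2 - A has rank 8; but a snake path meeting the cube in 9 cells
   would give a vector in the kernel of 2 - A supported on these cells, which a
   linear forest does not allow. Hence a snake path meets every translate of the
   cube in at most 8 of its 16 cells, and averaging over all translates gives the
   bound.

   Lower bound. In two consecutive rows the knight graph is a union of four
   zigzag paths; the pairs of rows 4j, 4j+1 do not interact. A rectangular spiral
   is made of such strips of width 4, parallel to the nearest side of the board.
   At each corner, two of the four zigzags of a strip are joined to each other
   and the other two are continued into the next strip; at the two ends of the
   spiral the latter two are joined to each other as well. The resulting induced
   subgraph is 2-regular and connected, hence a snake cycle, and fills half of
   the board up to O(m + n) cells near the diagonals and in the core. *)

(** * Snake paths and cycles in finite graphs *)

Section TwoRegular.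
Variables (T : finType) (e : rel T).
Hypotheses (e_sym : symmetric e) (e_irr : irreflexive e).

Lemma next_neq_prev (s : seq T) x : uniq s -> 2 < size s -> x \in s -> next s x != prev s x.
Proof.
move=> us ss xs; apply/eqP => np.
have : next s (next s x) = x by rewrite np next_prev.
case: (rot_to xs) => i p rotE.
have urot : uniq (x :: p) by rewrite -rotE rot_uniq.
have srot : 2 < size (x :: p) by rewrite -rotE size_rot.
rewrite -!(next_rot i us) rotE.
case: p {rotE np} urot srot => [|y [|z p]] //= /and3P[]; rewrite !inE.
rewrite !negb_or => /and3P[xy xz xp] /andP[yz yp] _ _.
rewrite eqxx /= eq_sym (negbTE xy) eqxx => zx.
by rewrite zx eqxx in xz.
Qed.

Variable S : {set T}.
Hypothesis deg2 : forall x, x \in S -> #|[set y in S | e x y]| = 2.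

Lemma two_neighbours x y z : x \in S -> y \in S -> z \in S -> e x y -> e x z -> y != z ->
  forall w, w \in S -> e x w -> (w == y) || (w == z).
Proof.
move=> xS yS zS exy exz yz w wS exw; apply: contraT; rewrite negb_or => /andP[wy wz].
have : #|[set w; y; z]| <= #|[set y in S | e x y]|.
  apply: subset_leq_card; apply/subsetP => t; rewrite !inE.
  by case/orP => [/orP[]|] /eqP ->; rewrite ?wS ?yS ?zS.
by rewrite deg2 // setUC cardsU1 !inE negb_or eq_sym wz eq_sym yz /= cards2 wy.
Qed.

Let is_path s := [&& sorted e s, uniq s & all (mem S) s].

(* The last vertex has all its neighbours on the path, and a neighbour other than
   its predecessor can only be the first vertex. *)
Lemma maximal_path_closes s : is_path s -> s != [::] ->
  (forall s', is_path s' -> size s' <= size s) -> (2 < size s) && cycle e s.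
Proof.
case/and3P => es us sS s0 smax.
case: s s0 es us sS smax => [|x p] // _ es us sS smax.
have ep : path e x p by exact: es.
set s := x :: p in es us sS smax *.
pose z := last x p.
have zs : z \in s by exact: mem_last.
have zS : z \in S by move/allP: sS => /(_ _ zs).
have : #|[set y in S | e z y]| = 2 by exact: deg2.
move=> /eqP /cards2P [w1 [w2 [w12 Ew]]].
have in_s w : w \in [set y in S | e z y] -> w \in s.
  rewrite inE => /andP[wS ezw]; apply: contraT => ws.
  have ps : is_path (rcons s w).
    by rewrite /is_path rcons_uniq ws us all_rcons sS /= wS rcons_path ep ezw.
  by have := smax _ ps; rewrite size_rcons ltnn.
have key w : w \in [set y in S | e z y] -> index w s = 0 \/ (index w s).+2 = size s.
  move=> wz; have ws := in_s _ wz; move: wz; rewrite inE => /andP[wS ezw].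
  have iws : index w s < size s by rewrite index_mem.
  set i := index w s in iws *; have wE : nth x s i = w by rewrite nth_index.
  case: i wE iws => [|i] wE iws; first by left.
  right; apply/eqP; rewrite eqn_leq; apply/andP; split.
    rewrite ltn_neqAle iws andbT; apply/eqP => E.
    have pi : size p = i.+1 by move: E; rewrite /s /= => -[].
    by rewrite -wE -pi -[nth _ _ _](last_nth x) e_irr in ezw.
  (* Otherwise [w] is interior, with path neighbours at [i] and [i.+2]; both differ from the last
     vertex [z], which would be a third neighbour. *)
  rewrite leqNgt; apply/negP => lt_i.
  have step k : k.+1 < size s -> e (nth x s k) (nth x s k.+1).
    by move=> hk; move/(pathP x): es; apply.
  have e1 : e w (nth x s i) by rewrite e_sym -wE; apply: step.
  have e2 : e w (nth x s i.+2) by rewrite -wE; apply: step; apply: leq_trans lt_i.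
  have nS k : k < size s -> nth x s k \in S by move=> hk; move/allP: sS; apply; exact: mem_nth.
  have ne : nth x s i != nth x s i.+2.
    rewrite nth_uniq //; last exact: leq_trans lt_i.
      by rewrite neq_ltn ltnS leqnSn.
    by apply: ltn_trans iws.
  have sp : size s = (size p).+1 by [].
  have zE : z = nth x s (size p) by rewrite /z (last_nth x).
  have hi : i < size s by apply: ltn_trans iws.
  have hi2 : i.+2 < size s by apply: leq_trans lt_i.
  have hp : size p < size s by rewrite sp.
  have := two_neighbours wS (nS _ hi) (nS _ hi2) e1 e2 ne zS.
  rewrite e_sym ezw zE !nth_uniq // => /(_ isT); move: lt_i; rewrite sp.
  by move: (size p) => q; clear; lia.
have zw w : w \in [set y in S | e z y] -> e z w by rewrite inE => /andP[].
have [w1z w2z] : w1 \in [set y in S | e z y] /\ w2 \in [set y in S | e z y].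
  by rewrite Ew !inE !eqxx orbT.
have inj w : w \in [set y in S | e z y] -> w = nth x s (index w s).
  by move=> /in_s ws; rewrite nth_index.
have [w w0 ss] : exists2 w, w \in [set y in S | e z y] /\ index w s = 0 & 2 < size s.
  case: (key _ w1z) (key _ w2z) => i1 [] i2.
  - by move: w12; rewrite (inj _ w1z) (inj _ w2z) i1 i2 eqxx.
  - by exists w1 => //; case: (index w2 s) i2 (inj _ w2z) => [|k] <- // E; move: w12; rewrite (inj _ w1z) i1 E eqxx.
  - by exists w2 => //; case: (index w1 s) i1 (inj _ w1z) => [|k] <- // E; move: w12; rewrite (inj _ w2z) i2 E eqxx.
  - have i12 : index w1 s = index w2 s by apply/eqP; rewrite -(eqn_add2r 2) !addn2 i1 i2.
    by move: w12; rewrite (inj _ w1z) (inj _ w2z) i12 eqxx.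
rewrite ss /= rcons_path ep /=.
by case: w0 => wz i0; move: (zw _ wz); rewrite (inj _ wz) i0.
Qed.

Hypothesis conn : forall A : {set T}, A \subset S -> A != set0 ->
  (forall x y, x \in A -> y \in S -> e x y -> y \in A) -> A = S.

(** A longest path in [S] closes into a cycle. By 2-regularity a cycle vertex has no neighbours in
    [S] but its successor and predecessor. So the cycle is induced, and its vertex set is closed
    under edges, whence it is all of [S] by [conn]. *)
Lemma two_regular_snake_cycle : S != set0 ->
  exists2 s : seq T, snake_cycle e s & size s = #|S|.
Proof.
move=> /set0Pn [x0 x0S].
pose Q k := [exists s : k.-tuple T, is_path s].
have Q1 : exists k, Q k.
  by exists 1; apply/existsP; exists [tuple x0]; rewrite /is_path /= x0S.
have Qb k : Q k -> k <= #|T|.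
  by case/existsP => s /and3P[_ us _]; rewrite -(size_tuple s) -(card_uniqP us) max_card.
case: (ex_maxnP Q1 Qb) => k /existsP[s ps] kmax.
have s0 : val s != [::].
  rewrite -size_eq0 size_tuple -lt0n; apply: kmax.
  by apply/existsP; exists [tuple x0]; rewrite /is_path /= x0S.
have smax s' : is_path s' -> size s' <= size s.
  by move=> ps'; rewrite size_tuple; apply: kmax; apply/existsP; exists (in_tuple s').
have /andP[ss cs] := maximal_path_closes ps s0 smax.
case/and3P: ps => _ us /allP sS.
have nb x y : x \in s -> y \in S -> e x y -> (y == next s x) || (y == prev s x).
  move=> xs yS exy; apply: (@two_neighbours x) => //.
  - exact: sS.
  - by apply: sS; rewrite mem_next.
  - by apply: sS; rewrite mem_prev.
  - exact: next_cycle.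
  - by rewrite e_sym; apply: prev_cycle.
  - exact: next_neq_prev.
have sE : [set x in s] = S.
  apply: conn.
  - by apply/subsetP => x; rewrite inE => /sS.
  - by apply/set0Pn; exists (nth x0 s 0); rewrite inE mem_nth // (leq_trans _ ss).
  move=> x y; rewrite !inE => xs yS /(nb _ _ xs yS).
  by case/orP => /eqP ->; rewrite ?mem_next ?mem_prev.
exists s; last by rewrite -sE cardsE (card_uniqP us).
rewrite /snake_cycle ss /ucycleb cs us /=; apply/forall_inP => x xs.
apply/forall_inP => y ys; apply/implyP => /(nb _ _ xs (sS _ ys)) /=.
by case/orP => /eqP ->; rewrite /cycle_edge /= ?(next_prev us) eqxx ?orbT.
Qed.
End TwoRegular.

(** Inducedness enters the upper bound in this form: a vertex of the snake has at most one neighbour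
    in the snake on each side. *)
Lemma snake_path_index (T : finType) (e : rel T) s x y : snake_path e s ->
  x \in s -> y \in s -> e x y ->
  index y s = (index x s).+1 \/ index x s = (index y s).+1.
Proof.
case/and4P => _ _ us /forall_inP ind xs ys exy.
have : path_edge s x y by have /forall_inP /(_ y ys) /implyP := ind x xs; apply.
have succ (u v : T) : infix [:: u; v] s -> index v s = (index u s).+1.
  case/infixP => p [q sE]; move: us; rewrite sE cat_uniq => /and3P[_ /hasPn np uq].
  have up : u \notin p by apply: np; rewrite mem_head.
  have vp : v \notin p by apply: np; rewrite inE mem_head orbT.
  have uv : u != v by move: uq; rewrite /= inE negb_or -andbA => /and3P[].
  by rewrite !index_cat (negbTE up) (negbTE vp) /= !eqxx (negbTE uv); rewrite !inE !eqxx /= ?orbT /= addn0 addn1.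
by case/orP => /succ; [left | right].
Qed.

(** Deleting a vertex opens the cycle, and a cycle edge avoiding that vertex is a path edge. This
    transfers the upper bound to cycles and the lower bound to paths. *)
Lemma snake_cycle_path (T : finType) (e : rel T) s : snake_cycle e s ->
  exists2 p : seq T, snake_path e p & (size p).+1 = size s.
Proof.
case/and3P; case: s => [|x p] // ss /andP[cs us] /forall_inP ind; exists p => //.
have [xp up] : x \notin p /\ uniq p by case/andP: us.
apply/and4P; split=> //.
- by move: ss; case: (p).
- by move: cs => /=; rewrite rcons_path => /andP[/path_sorted].
apply/forall_inP => u uin; apply/forall_inP => v vin; apply/implyP => euv.
have nxt w t : w \in p -> t \in p -> next (x :: p) w = t -> infix [:: w; t] p.
  move=> wp tp; rewrite next_nth inE wp orbT /=.
  have -> : (x == w) = false by apply: contraNF xp => /eqP ->.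
  case/splitPr: wp up xp tp {cs us ss ind uin vin euv} => p1 p2 up xp tp.
  have wp1 : w \notin p1.
    by move: up; rewrite cat_uniq => /and3P[_ /hasPn np _]; apply: np; rewrite mem_head.
  rewrite index_cat (negbTE wp1) /= eqxx addn0 nth_cat ltnNge leqnSn /= subSnn /=.
  case: p2 up xp tp => [|y p2] up xp tp /= E; first by rewrite E tp in xp.
  by rewrite E (_ : [:: w, t & p2] = [:: w; t] ++ p2) // infix_infix.
have := ind u; rewrite inE uin orbT => /(_ isT) /forall_inP /(_ v).
rewrite inE vin orbT => /(_ isT) /implyP /(_ euv).
by rewrite /path_edge /=; case/orP => /eqP /nxt ->; rewrite ?orbT.
Qed.

(** * Huang's signed cube *)

Local Open Scope ring_scope.

(** Doubling is written as a sum so that the blocks of [cube_mx] typecheck by computation. *)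
Fixpoint cube_dim d : nat := if d is d'.+1 then (cube_dim d' + cube_dim d')%N else 1.

Fixpoint cube_mx d : 'M[rat]_(cube_dim d) :=
  if d is d'.+1 then block_mx (cube_mx d') 1%:M 1%:M (- cube_mx d') else 0.

(** The opposite signs of the diagonal blocks cancel the off-diagonal blocks of the square; the
    identity blocks add 1 on the diagonal. *)
Lemma cube_mx_sqr d : cube_mx d *m cube_mx d = d%:R%:M.
Proof.
elim: d => [|d IH] /=; first by rewrite mul0mx mulr0n raddf0.
rewrite mulmx_block !mulmx1 !mul1mx mulNmx mulmxN opprK IH !subrr.
by rewrite [RHS]scalar_mx_block -natr1 raddfD /= addrC.
Qed.

(** Since [B] squares to 3, [2 - B] and [2 + B] are mutually inverse. This factors [2 - A] through
    dimension 8. *)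
Lemma rank_cube4 : (\rank (2%:R%:M - cube_mx 4)%R <= 8)%N.
Proof.
set B := cube_mx 3.
have sqr1 : (2%:R%:M - B) *m (2%:R%:M + B) = 1%:M.
  rewrite mulmxDr !mulmxBl cube_mx_sqr -!scalar_mxM [B *m _%:M]scalar_mxC.
  by rewrite addrA addrNK -raddfB /= -natrM -natrB.
pose N : 'M[rat]_(cube_dim 3 + cube_dim 3) := 2%:R%:M - block_mx B 1%:M 1%:M (- B).
rewrite -[_ - cube_mx 4]/N.
have -> : N = col_mx (2%:R%:M - B) (- 1%:M) *m row_mx 1%:M (- (2%:R%:M + B)).
  rewrite mul_col_row !mulmx1 mulmxN sqr1 mulNmx mulmxN opprK !mul1mx /N.
  by rewrite scalar_mx_block opp_block_mx add_block_mx !sub0r opprK.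
apply: leq_trans (mulmx_max_rank _ _) _.
by [].
Qed.

Lemma tr_cube_mx d : (cube_mx d)^T = cube_mx d.
Proof.
elim: d => [|d IH] /=; first by rewrite trmx0.
by rewrite tr_block_mx !trmx1 linearN /= IH.
Qed.

Definition cube_dir : seq (int * int) := [:: (1, 2); (2, 1); (2, -1); (1, -2)].

Fixpoint cube_pos d : 'I_(cube_dim d) -> int * int :=
  if d is d'.+1 then fun i => match split i with
    | inl j => cube_pos j
    | inr j => cube_pos j + nth 0 cube_dir d'
    end else fun=> 0.

Lemma cube_mx_nz d i j : cube_mx d i j != 0 -> `|cube_mx d i j| = 1 /\
  exists2 k, (k < d)%N & (cube_pos j - cube_pos i == nth 0 cube_dir k) ||
                         (cube_pos j - cube_pos i == - nth 0 cube_dir k).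
Proof.
elim: d i j => [|d IH] i j; first by rewrite mxE eqxx.
move=> /=.
case: (split_ordP i) => i' ->; case: (split_ordP j) => j' ->.
- rewrite block_mxEul => /IH [nz [k kd kE]]; split=> //; exists k => //.
  exact: ltnW.
- rewrite block_mxEur mxE; case: (i' =P j') => [-> _|_]; last by rewrite eqxx.
  split; first by rewrite normr1.
  by exists d => //; rewrite addrAC subrr add0r eqxx.
- rewrite block_mxEdl mxE; case: (i' =P j') => [-> _|_]; last by rewrite eqxx.
  split; first by rewrite normr1.
  by exists d => //; rewrite opprD addrA subrr add0r eqxx orbT.
rewrite block_mxEdr mxE oppr_eq0 normrN => /IH [nz [k kd kE]]; split=> //.
by exists k; [exact: ltnW | rewrite opprD addrACA subrr addr0].
Qed.

Lemma cube_dir_far (k d : nat) : (k < d)%N -> (d < 4)%N ->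
  (nth 0 cube_dir d != nth 0 cube_dir k) && (nth 0 cube_dir d != - nth 0 cube_dir k).
Proof. by case: d => [|[|[|[|d]]]] //; case: k => [|[|[|[|k]]]]. Qed.

(* The row of i in the cube only reaches distinct cells, so that two cube
   neighbours of i never become one cell of the board. *)
Lemma cube_pos_inj d i j j' : (d <= 4)%N -> cube_mx d i j != 0 -> cube_mx d i j' != 0 ->
  cube_pos j = cube_pos j' -> j = j'.
Proof.
elim: d i j j' => [|d IH] i j j' hd; first by rewrite mxE eqxx.
(* A neighbour in the same half is reached by an earlier direction up to sign, so it cannot coincide
   with the neighbour in the other half. *)
have far (i0 j0 : 'I_(cube_dim d)) v : cube_mx d i0 j0 != 0 ->
    cube_pos j0 = cube_pos i0 + v -> v = nth 0 cube_dir d \/ v = - nth 0 cube_dir d -> False.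
  move=> /cube_mx_nz [_ [k kd kE]] vE.
  move: kE; rewrite vE addrAC subrr add0r => kE vd.
  have /andP[/negbTE n1 /negbTE n2] := cube_dir_far kd hd.
  by case: vd kE => ->; rewrite ?n1 ?n2 // eqr_oppLR eqr_opp n1 n2.
have posl j0 : cube_pos (lshift _ j0 : 'I_(cube_dim d.+1)) = cube_pos j0.
  by rewrite /= -[lshift _ _]/(unsplit (inl j0)) unsplitK.
have posr j0 : cube_pos (rshift _ j0 : 'I_(cube_dim d.+1)) = cube_pos j0 + nth 0 cube_dir d.
  by rewrite /= -[rshift _ _]/(unsplit (inr j0)) unsplitK.
have one (i0 j0 : 'I_(cube_dim d)) : (1%:M : 'M[rat]__) i0 j0 != 0 -> i0 = j0.
  by rewrite mxE; case: (i0 =P j0) => // _; rewrite eqxx.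
have IH' := IH _ _ _ (ltnW hd).
case: (split_ordP i) => i' ->; case: (split_ordP j) => j1 ->; case: (split_ordP j') => j2 ->;
  rewrite !(posl, posr) /= ?block_mxEul ?block_mxEur ?block_mxEdl ?block_mxEdr.
- by move=> h1 h2 /(IH' _ _ _ h1 h2) ->.
- by move=> /far h1 /one <- h; case: (h1 _ h); left.
- by move=> /one <- /far h1 h; case: (h1 _ (esym h)); left.
- by move=> /one <- /one <-.
- by move=> /one <- /one <-.
- move=> /one <-; rewrite mxE oppr_eq0 => /far h1 h.
  by case: (h1 (- nth 0 cube_dir d)); [rewrite h addrK | right].
- rewrite mxE oppr_eq0 => /far h1 /one <- h.
  by case: (h1 (- nth 0 cube_dir d)); [rewrite -h addrK | right].
by rewrite !mxE !oppr_eq0 => h1 h2 /addIr /(IH' _ _ _ h1 h2) ->.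
Qed.

(** For [d = 4] this gives the margin 8 around the board in the averaging argument. *)
Lemma cube_pos_bound d (i : 'I_(cube_dim d)) :
  (`|(cube_pos i).1| <= (2 * d)%:Z) && (`|(cube_pos i).2| <= (2 * d)%:Z).
Proof.
elim: d i => [|d IH] i //=.
case: (splitP i) => j _ /=; first by have := IH j; lia.
have : (`|(nth 0 cube_dir d).1| <= 2) && (`|(nth 0 cube_dir d).2| <= 2).
  by case: d {i j IH} => [|[|[|[|d]]]] //; rewrite nth_default.
by have := IH j; case: (cube_pos j) => ? ?; case: (nth _ _ _) => ? ? /=; lia.
Qed.

Lemma sum_subsingleton (V : nmodType) (I : finType) (P : pred I) (F : I -> V) :
  (forall i j, P i -> P j -> i = j) ->
  \sum_(i | P i) F i = 0 \/ exists2 i, P i & \sum_(i | P i) F i = F i.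
Proof.
move=> Pinj; case: (pickP P) => [i Pi|P0]; last by left; rewrite big_pred0.
right; exists i => //; rewrite (big_pred1 i) // => j.
by apply/idP/eqP => [Pj|-> //]; exact: Pinj.
Qed.

Section CubePath.
Variables (T : finType) (e : rel T) (s : seq T).
Hypothesis sp : snake_path e s.
Variable W : {set 'I_(cube_dim 4)}.
Variable g : 'I_(cube_dim 4) -> T.
Hypothesis gW : forall i, i \in W -> g i \in s.
Hypothesis g_adj : forall i j, i \in W -> j \in W -> cube_mx 4 i j != 0 -> e (g i) (g j).
Hypothesis g_inj : forall i j j', i \in W -> j \in W -> j' \in W ->
  cube_mx 4 i j != 0 -> cube_mx 4 i j' != 0 -> g j = g j' -> j = j'.

(** Any nine rows of [2 - A] are dependent. A vanishing combination [x] satisfies [2 x = x A] at the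
    nine chosen vertices, where the right-hand side has at most one term for each side of the path;
    [g_inj] ensures that two cube neighbours do not share a path position. *)
Lemma snake_path_cube : (#|W| <= 8)%N.
Proof.
rewrite leqNgt; apply/negP => W8.
pose f (k : 'I_9) : 'I_(cube_dim 4) := enum_val (widen_ord W8 k).
have fW k : f k \in W by exact: enum_valP.
have f_inj : injective f by move=> k k' /enum_val_inj /(congr1 val) /= /val_inj.
pose N := 2%:R%:M - cube_mx 4.
have NE i j : N i j = 2%:R *+ (i == j) - cube_mx 4 j i.
  by rewrite -[in RHS]tr_cube_mx /N; move: (cube_mx 4) => A; rewrite !mxE.
have rkN : (\rank N <= 8)%N by exact: rank_cube4.
clearbody N.
have [x x0 xN] : exists2 x : 'rV_9, x != 0 & x *m rowsub f N = 0.
  have : kermx (rowsub f N) != 0.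
    rewrite kermx_eq0 /row_free rowsubE neq_ltn.
    by rewrite (leq_ltn_trans (mxrankM_maxr _ _)) // ltnS.
  by case/rowV0Pn => x /sub_kermxP xN x0; exists x.
have kerE k : 2%:R * x 0 k = \sum_l x 0 l * cube_mx 4 (f k) (f l).
  have /rowP /(_ (f k)) := xN; rewrite !mxE.
  under eq_bigr => l _ do rewrite !mxE NE mulrBr.
  rewrite sumrB => /eqP; rewrite subr_eq0 => /eqP <-.
  rewrite (bigD1 k) //= eqxx mulr1n mulrC big1 ?addr0 // => l lk.
  by rewrite (inj_eq f_inj) (negbTE lk) mulr0.
have [k0 _ k0max'] := @arg_maxP _ _ _ (0 : 'I_9) xpredT (fun k => `|x 0 k|) isT.
set M := `|x 0 k0| in k0max'.
have k0max k : `|x 0 k| <= M by exact: k0max'.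
have M0 : 0 < M.
  rewrite normr_gt0; apply: contraNneq x0 => xk; apply/eqP/rowP => k.
  by apply/eqP; have := k0max k; rewrite /M xk normr0 normr_le0 mxE.
(* Among the coordinates of maximal modulus, consider the cell that the path
   visits first: its predecessor on the path has a smaller coordinate, so the
   kernel equation fails there. *)
pose T0 := [pred k | `|x 0 k| == M].
have [k /eqP kM kmin] := @arg_minnP _ k0 T0 (fun k => index (g (f k)) s) (eqxx _).
have idx l : cube_mx 4 (f k) (f l) != 0 ->
    index (g (f l)) s = (index (g (f k)) s).+1 \/ index (g (f k)) s = (index (g (f l)) s).+1.
  move=> nz; exact: snake_path_index sp (gW (fW k)) (gW (fW l)) (g_adj (fW k) (fW l) nz).
pose up l := index (g (f l)) s == (index (g (f k)) s).+1.
have nzle l : `|x 0 l * cube_mx 4 (f k) (f l)| <= if cube_mx 4 (f k) (f l) != 0 then `|x 0 l| else 0.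
  rewrite normrM; case: eqP => [->|/eqP /cube_mx_nz [->]] /=; by rewrite ?normr0 ?mulr0 ?mulr1.
have same l l' : cube_mx 4 (f k) (f l) != 0 -> cube_mx 4 (f k) (f l') != 0 ->
    index (g (f l)) s = index (g (f l')) s -> l = l'.
  move=> nz nz' E; apply: f_inj; apply: (g_inj (fW k)) nz nz' _ => //.
  by rewrite -[LHS](nth_index (g (f l)) (gW (fW l))) E nth_index // gW.
have : 2%:R * M < M + M.
  rewrite -[in X in X < _]kM -[2%:R]ger0_norm // -normrM kerE.
  apply: le_lt_trans (ler_norm_sum _ _ _) _.
  apply: le_lt_trans (ler_sum _ (fun l _ => nzle l)) _.
  rewrite -big_mkcond (bigID up) /=; apply: ler_ltD.
    case: (@sum_subsingleton _ _ (fun l => (cube_mx 4 (f k) (f l) != 0) && up l) (fun l => `|x 0 l|)).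
    - by move=> l l' /andP[nz /eqP ul] /andP[nz' /eqP ul']; apply: same => //; rewrite ul ul'.
    - by move=> ->; exact: ltW.
    - by case=> l _ ->; exact: k0max.
  have down l : (cube_mx 4 (f k) (f l) != 0) && ~~ up l -> index (g (f k)) s = (index (g (f l)) s).+1.
    by case/andP => /idx[/eqP ul|//]; rewrite /up ul.
  case: (@sum_subsingleton _ _ (fun l => (cube_mx 4 (f k) (f l) != 0) && ~~ up l) (fun l => `|x 0 l|)).
  - move=> l l' hl hl'; case/andP: (hl) (hl') => nz _ /andP[nz' _]; apply: same => //.
    by apply: succn_inj; rewrite -!down.
  - by move=> ->.
  - case=> l hl ->; rewrite lt_neqAle k0max // andbT; apply/negP => lM.
    by have := kmin l lM; rewrite (down l hl) ltnn.
by rewrite mulr_natl mulr2n ltxx.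
Qed.

End CubePath.

(** * The upper bound *)

Definition moves : seq (int * int) :=
  [:: (1, 2); (1, -2); (-1, 2); (-1, -2); (2, 1); (2, -1); (-2, 1); (-2, -1)].

Lemma movesE i j : ((i, j) \in moves) =
  (`|i| == 1) && (`|j| == 2) || (`|i| == 2) && (`|j| == 1).
Proof. rewrite /moves !inE !xpair_eqE; lia. Qed.

Lemma moves_bound i j : (i, j) \in moves -> (-2 <= i <= 2) && (-2 <= j <= 2).
Proof. rewrite movesE; lia. Qed.

Definition cell_coord (m n : nat) (c : cell m n) : int * int := (Posz c.1, Posz c.2).

Lemma cell_coord_inj m n : injective (@cell_coord m n).
Proof. by move=> [[x hx] [y hy]] [[x' hx'] [y' hy']] [/= *]; congr pair; apply: val_inj. Qed.

Lemma knightE m n (u v : cell m n) : knight u v = (cell_coord v - cell_coord u \in moves).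
Proof. by rewrite /cell_coord movesE /knight /= !(distrC (Posz u.1)) !(distrC (Posz u.2)). Qed.

Lemma knight_sym m n : symmetric (@knight m n).
Proof. by move=> u v; rewrite /knight !(distrC (Posz u.1)) !(distrC (Posz u.2)). Qed.

Lemma knight_irr m n : irreflexive (@knight m n).
Proof. by move=> u; rewrite /knight !subrr. Qed.

Lemma cube_dir_moves k : (k < 4)%N -> (nth 0 cube_dir k \in moves) && (- nth 0 cube_dir k \in moves).
Proof. by case: k => [|[|[|[|k]]]]. Qed.

Lemma snake_path_translate m n (s : seq (cell m n)) (t : int * int) : snake_path (@knight m n) s ->
  (#|[set i : 'I_(cube_dim 4) | has (fun c => (cell_coord c == t + cube_pos i)%R) s]| <= 8)%N.
Proof.
move=> sp; set W := [set i | _].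
have [c0 _] : exists c0 : cell m n, c0 \in s.
  by case: s {W} sp => [|c s] // _; exists c; rewrite mem_head.
pose g (i : 'I_(cube_dim 4)) := nth c0 s (find (fun c => cell_coord c == t + cube_pos i) s).
have gE i : i \in W -> cell_coord (g i) = t + cube_pos i by rewrite inE => /(nth_find c0) /eqP.
apply: (snake_path_cube sp (g := g)).
- by move=> i; rewrite inE has_find => /mem_nth; apply.
- move=> i j iW jW /cube_mx_nz [_ [k kd]]; rewrite knightE !gE //.
  rewrite opprD addrACA subrr add0r.
  by case/andP: (cube_dir_moves kd) => h1 h2 /orP[] /eqP ->.
- by move=> i j j' iW jW jW' nz nz' /(congr1 (@cell_coord m n)); rewrite !gE // => /addrI; exact: cube_pos_inj nz nz'.
Qed.

(** Double counting of pairs of a translate and a cube vertex landing on the snake: each cell of the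
    snake occurs 16 times, each translate at most 8 times. *)
Lemma snake_path_upper m n (s : seq (cell m n)) : snake_path (@knight m n) s ->
  (2 * size s <= (n + 16) * (m + 16))%N.
Proof.
move=> sp.
pose D := ('I_(n + 15).+1 * 'I_(m + 15).+1)%type.
pose tr (d : D) : int * int := (Posz d.1 - 8, Posz d.2 - 8).
pose hit (d : D) (i : 'I_(cube_dim 4)) := has (fun c => cell_coord c == tr d + cube_pos i) s.
have le1 : (\sum_(d : D) #|[set i : 'I_(cube_dim 4) | hit d i]| <= 8 * ((n + 16) * (m + 16)))%N.
  apply: leq_trans (_ : \sum_(d : D) 8 <= _)%N.
    by apply: leq_sum => d _; exact: snake_path_translate.
  by rewrite sum_nat_const card_prod !card_ord mulnC !addnS.
have ge1 : (16 * size s <= \sum_(d : D) #|[set i : 'I_(cube_dim 4) | hit d i]|)%N.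
  have -> : (\sum_(d : D) #|[set i : 'I_(cube_dim 4) | hit d i]| =
      \sum_(i : 'I_(cube_dim 4)) #|[set d : D | hit d i]|)%N.
    transitivity (\sum_(d : D) \sum_(i : 'I_(cube_dim 4)) hit d i)%N.
      by apply: eq_bigr => d _; rewrite -sum1dep_card big_mkcond; apply: eq_bigr => i _; case: ifP.
    rewrite exchange_big; apply: eq_bigr => i _ /=.
    by rewrite -sum1dep_card [RHS]big_mkcond; apply: eq_bigr => d _; case: ifP.
  apply: leq_trans (_ : \sum_(i : 'I_(cube_dim 4)) size s <= _)%N.
    by rewrite sum_nat_const card_ord.
  apply: leq_sum => i _.
  have us : uniq s by case/and4P: sp.
  (* The translate that puts cube vertex [i] on the cell [c]. *)
  pose h (c : cell m n) : D :=
    (inord (absz (Posz c.1 + 8 - (cube_pos i).1)%R), inord (absz (Posz c.2 + 8 - (cube_pos i).2)%R)).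
  have pb := cube_pos_bound i.
  have hE c : tr (h c) + cube_pos i = cell_coord c.
    rewrite /tr /h /cell_coord; case: c => [[x hx] [y hy]].
    by case: (cube_pos i) pb => p q /= pb; rewrite !inordK; [congr pair => /=| |]; lia.
  have h_inj : injective h by move=> c c' E; apply: cell_coord_inj; rewrite -!hE E.
  rewrite -(card_uniqP us) -(card_imset _ h_inj) subset_leq_card //.
  apply/subsetP => d /imsetP[c cs ->]; rewrite inE; apply/hasP; exists c => //.
  by rewrite hE.
by lia.
Qed.

(** * The spiral is 2-regular *)

Definition deg (P : int -> int -> bool) (x y : int) : nat :=
  count (fun d => P (x + d.1) (y + d.2)) moves.

(** Used with [f] a reflection or the transposition, to reduce all corners to one. *)
Lemma deg_map (f : int * int -> int * int) (P P' : int -> int -> bool) x y x' y' :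
  perm_eq (map f moves) moves ->
  (forall i j, (i, j) \in moves ->
     P (x + i) (y + j) = P' (x' + (f (i, j)).1) (y' + (f (i, j)).2)) ->
  deg P x y = deg P' x' y'.
Proof.
move=> /permP pm eqP; rewrite {2}/deg -pm count_map.
by apply: eq_in_count => -[i j] /eqP.
Qed.

Lemma eq_deg (P P' : int -> int -> bool) x y x' y' :
  (forall i j, (i, j) \in moves -> P (x + i) (y + j) = P' (x' + i) (y' + j)) ->
  deg P x y = deg P' x' y'.
Proof. by move=> eqP; apply: eq_in_count => -[i j] /eqP. Qed.

(* Coordinates near the end of a strip: t along the strip, v across it. For
   c = false the strip turns into the next one; for c = true it is the first or
   the last strip, and the cell (3, 2) is moved to (3, 0) in order to join the two
   zigzags that would have been continued. *)
Definition strip_end (c : bool) (t v : int) : bool :=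
  [|| (v == 0) && (6 <= t), (v == 1) && (5 <= t), (v == 2) && (4 <= t <= 5)
    | (t == 3) && (v == if c then 0 else 2)].

(* The corner at the origin of a quadrant whose strips 4i <= v < 4i + 4 run along
   the u-axis for i in I and the strips 4i <= u < 4i + 4 along the v-axis for i in
   J; the i-th strips of the two kinds are connected when both exist. *)
Definition arm (I J : pred int) (u v : int) : bool :=
  let i := (v %/ 4)%Z in I i && strip_end (~~ J i) (u - 4 * i) (v - 4 * i).

Definition corner (I J : pred int) (u v : int) : bool := arm I J u v || arm J I v u.

(* The part of a corner belonging to one value of i, translated to i = 0. *)
Definition ring_corner (a b : bool) (u v : int) : bool :=
  a && strip_end (~~ b) u v || b && strip_end (~~ a) v u.

Lemma strip_end_far c t v : 6 <= t -> strip_end c t v = (v == 0) || (v == 1).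
Proof. rewrite /strip_end; lia. Qed.

Lemma strip_end_high c t v : 3 <= v -> strip_end c t v = false.
Proof. rewrite /strip_end; case: c; lia. Qed.

(** For [u < 10] this is a finite check. Beyond, every cell within a move sees just two full rows,
    where each cell lies inside a zigzag. *)
Lemma ring_corner_deg b u v : strip_end (~~ b) u v -> deg (ring_corner true b) u v = 2.
Proof.
move=> Huv.
have [lt_u|ge_u] := ltP u 10.
  have check : all (fun n : nat => all (fun k : nat => strip_end (~~ b) n k ==>
      (deg (ring_corner true b) n k == 2)) (iota 0 3)) (iota 3 7).
    by case: b {Huv}; vm_compute.
  have ub : (3 <= u < 10) && (0 <= v < 3) by move: Huv; rewrite /strip_end; case: b {check} => /=; lia.
  have [n un] : exists n : nat, u = n by exists `|u|%N; lia.
  have [k vk] : exists k : nat, v = k by exists `|v|%N; lia.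
  subst u v; apply/eqP; move/allP: check => /(_ n); rewrite mem_iota.
  move=> /(_ ltac:(lia)) /allP /(_ k); rewrite mem_iota => /(_ ltac:(lia)).
  by rewrite Huv.
transitivity (deg (fun x y : int => (y == 0) || (y == 1)) u v).
  apply: eq_deg => i j /moves_bound mv.
  rewrite /ring_corner /= strip_end_far; last by lia.
  by rewrite strip_end_high ?andbF ?orbF //; lia.
have [->|->] : v = 0 \/ v = 1 by move: Huv; rewrite strip_end_far; lia.
all: by [].
Qed.

(** Parts of different index are out of reach of each other: strips are 4 rows apart, and row 2 is
    used only near the end of a strip, where the next strip, also shifted by 4 lengthwise, has not
    begun. *)
Lemma corner_local I J u v i j : (i, j) \in moves ->
  arm I J u v -> let k := (v %/ 4)%Z in
  corner I J (u + i) (v + j) = ring_corner (I k) (J k) (u - 4 * k + i) (v - 4 * k + j).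
Proof.
rewrite movesE => mv /andP[Ik]; set k := (v %/ 4)%Z in Ik * => Hs /=.
have Hs' : strip_end true (u - 4 * k) (v - 4 * k) || strip_end false (u - 4 * k) (v - 4 * k).
  by case: (J k) Hs => ->; rewrite ?orbT.
have same c i' : (i' != k) ->
   strip_end c (u + i - 4 * i') (v + j - 4 * i') = false
   /\ strip_end c (v + j - 4 * i') (u + i - 4 * i') = false.
  move: Hs'; rewrite /strip_end; case: c; lia.
have eq1 : arm I J (u + i) (v + j) = I k && strip_end (~~ J k) (u - 4 * k + i) (v - 4 * k + j).
  rewrite /arm; set i' := ((v + j) %/ 4)%Z; have [->|ne] := eqVneq i' k.
    by rewrite (addrAC u) (addrAC v).
  rewrite (same _ _ ne).1 andbF Ik; symmetry; apply/negP.
  move: Hs'; case: (J k); rewrite /strip_end /=; lia.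
have eq2 : arm J I (v + j) (u + i) = J k && strip_end (~~ I k) (v - 4 * k + j) (u - 4 * k + i).
  rewrite /arm; set i' := ((u + i) %/ 4)%Z; have [->|ne] := eqVneq i' k.
    by rewrite (addrAC u) (addrAC v).
  rewrite (same _ _ ne).2 andbF Ik; symmetry; apply/negP.
  move: Hs'; rewrite /strip_end /=; lia.
by rewrite /corner eq1 eq2.
Qed.

Lemma corner_sym I J u v : corner I J u v = corner J I v u.
Proof. by rewrite /corner orbC. Qed.

Lemma deg_corner I J u v : corner I J u v -> deg (corner I J) u v = 2.
Proof.
wlog: I J u v / arm I J u v => [H|Ha _].
  case/orP => Ha; first by apply: (H I J u v) => //; rewrite /corner Ha.
  rewrite -(H J I v u Ha); last by rewrite /corner Ha.
  apply: (@deg_map (fun d => (d.2, d.1))) => // i j _; exact: corner_sym.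
case/andP: (Ha); set k := (v %/ 4)%Z => Ik /ring_corner_deg <-.
by apply: eq_deg => i j mv; rewrite (corner_local mv Ha) -/k Ik.
Qed.

(* A full strip of length l, with the two end shapes given by c and c'. *)
Definition strip (c c' : bool) (l t v : int) : bool :=
  [|| (v == 0) && (6 <= t <= l - 6), (v == 1) && (5 <= t <= l - 5),
      (v == 2) && ((4 <= t <= 5) || (4 <= l - t <= 5)),
      (t == 3) && (v == if c then 0 else 2) | (l - t == 3) && (v == if c' then 0 else 2)].

Lemma strip_left c c' l t v : t <= l - 6 -> strip c c' l t v = strip_end c t v.
Proof. rewrite /strip /strip_end; case: c'; lia. Qed.

Lemma strip_right c c' l t v : 6 <= t -> strip c c' l t v = strip_end c' (l - t) v.
Proof. rewrite /strip /strip_end; case: c; lia. Qed.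

Lemma strip_bound c c' l t v : 8 <= l -> strip c c' l t v -> (3 <= t <= l - 3) && (0 <= v <= 2).
Proof. rewrite /strip; case: c; case: c'; lia. Qed.

Section Spiral.
Variables a n m : int.

(* The spiral lives in -4 <= x < n, 0 <= y < m and winds a times, in the order
   south, east, north, west; the west strip j turns into the south strip j + 1,
   whence the shift by 4 in the south-west corner. *)
Definition south (x y : int) : bool := let j := (y %/ 4)%Z in
  (0 <= j < a) && strip (j == 0) false (n + 3 - 8 * j) (x - 4 * j + 4) (y - 4 * j).
Definition east (x y : int) : bool := let j := ((n - 1 - x) %/ 4)%Z in
  (0 <= j < a) && strip false false (m - 1 - 8 * j) (y - 4 * j) (n - 1 - x - 4 * j).
Definition north (x y : int) : bool := let j := ((m - 1 - y) %/ 4)%Z in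
  (0 <= j < a) && strip false false (n - 1 - 8 * j) (n - 1 - x - 4 * j) (m - 1 - y - 4 * j).
Definition west (x y : int) : bool := let j := (x %/ 4)%Z in
  (0 <= j < a) && strip false (j == a - 1) (m - 5 - 8 * j) (m - 1 - y - 4 * j) (x - 4 * j).
Definition spiral (x y : int) : bool := [|| south x y, east x y, north x y | west x y].

Hypotheses (a_gt0 : 0 < a) (n_ge : 8 * a + 17 <= n) (m_ge : 8 * a + 17 <= m).

Let I : pred int := fun i => 0 <= i < a.
(** In the south-west corner, index [i] pairs the west strip [i] with the south strip [i + 1]. Index
    [-1] has only a south strip and [a - 1] only a west one: these are the two closed ends of the
    spiral. *)
Let J : pred int := fun i => -1 <= i < a - 1.

(** Each quadrant extends 2 cells past the middle lines, the reach of a move, so that a cell and its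
    neighbours are described by one corner. *)
Lemma spiral_se x y : n - 4 <= 2 * x -> 2 * y <= m + 4 ->
  spiral x y = corner I I (n - 1 - x) y.
Proof.
move=> hx hy; rewrite /spiral /corner.
have -> : north x y = false by apply/negP; rewrite /north => /andP[]; lia.
have -> : west x y = false by apply/negP; rewrite /west => /andP[]; lia.
rewrite !orbF /south /east /arm /I; congr orb.
  apply: andb_id2l => ij; rewrite ?ij /= strip_right; last by lia. congr strip_end; lia.
apply: andb_id2l => ij; rewrite ?ij /= strip_left //; lia.
Qed.

Lemma spiral_ne x y : n - 4 <= 2 * x -> m - 4 <= 2 * y ->
  spiral x y = corner I I (n - 1 - x) (m - 1 - y).
Proof.
move=> hx hy; rewrite /spiral /corner.
have -> : south x y = false by apply/negP; rewrite /south => /andP[]; lia.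
have -> : west x y = false by apply/negP; rewrite /west => /andP[]; lia.
rewrite orbF /= orbC /north /east /arm /I; congr orb.
  apply: andb_id2l => ij; rewrite ?ij /= strip_left //; lia.
apply: andb_id2l => ij; rewrite ?ij /= strip_right; last by lia. congr strip_end; lia.
Qed.

Lemma spiral_nw x y : 2 * x <= n + 4 -> m - 4 <= 2 * y ->
  spiral x y = corner I I x (m - 1 - y).
Proof.
move=> hx hy; rewrite /spiral /corner.
have -> : south x y = false by apply/negP; rewrite /south => /andP[]; lia.
have -> : east x y = false by apply/negP; rewrite /east => /andP[]; lia.
rewrite /= /north /west /arm /I; congr orb.
  apply: andb_id2l => ij; rewrite ?ij /= strip_right; last by lia. congr strip_end; lia.
apply: andb_id2l => ij; rewrite ?ij /= strip_left //; lia.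
Qed.

Lemma spiral_sw x y : 2 * x <= n + 4 -> 2 * y <= m + 4 ->
  spiral x y = corner J I x (y - 4).
Proof.
move=> hx hy; rewrite /spiral /corner.
have -> : east x y = false by apply/negP; rewrite /east => /andP[]; lia.
have -> : north x y = false by apply/negP; rewrite /north => /andP[]; lia.
rewrite /= /south /west /arm /I /J; congr orb.
  have -> : ((y - 4) %/ 4)%Z = (y %/ 4)%Z - 1 by lia.
  set j := (y %/ 4)%Z; rewrite (_ : (-1 <= j - 1 < a - 1) = (0 <= j < a)); last by lia.
  apply: andb_id2l => ij; rewrite ?ij /= strip_left; last by lia. congr strip_end; lia.
apply: andb_id2l => ij; rewrite ?ij /= strip_right; last by lia. congr strip_end; lia.
Qed.

Lemma deg_spiral x y : spiral x y -> deg spiral x y = 2.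
Proof.
have [hx|hx] := leP n (2 * x); have [hy|hy] := leP m (2 * y).
- rewrite spiral_ne; try lia; move=> /deg_corner <-.
  apply: (@deg_map (fun d => (- d.1, - d.2))) => // i j /moves_bound ij /=.
  rewrite spiral_ne; try lia; congr corner; lia.
- rewrite spiral_se; try lia; move=> /deg_corner <-.
  apply: (@deg_map (fun d => (- d.1, d.2))) => // i j /moves_bound ij /=.
  rewrite spiral_se; try lia; congr corner; lia.
- rewrite spiral_nw; try lia; move=> /deg_corner <-.
  apply: (@deg_map (fun d => (d.1, - d.2))) => // i j /moves_bound ij /=.
  rewrite spiral_nw; try lia; congr corner; lia.
- rewrite spiral_sw; try lia; move=> /deg_corner <-.
  apply: eq_deg => i j /moves_bound ij /=.
  rewrite spiral_sw; try lia; congr corner; lia.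
Qed.

Lemma spiral_bound x y : spiral x y -> (-4 <= x < n) && (0 <= y < m).
Proof.
case/or4P => /andP[] ij /strip_bound; lia.
Qed.

End Spiral.

(** * The spiral is connected *)

(** Connectedness is proved by propagation: [G] stands for the cells already reached inside [S]. *)
Definition knight_closed (S : int -> int -> bool) (G : int -> int -> Prop) : Prop :=
  forall x y x' y', (x' - x, y' - y) \in moves -> S x' y' -> G x y -> G x' y'.

Section StripReach.
Variables (S : int -> int -> bool) (G : int -> int -> Prop) (c c' : bool) (l : int).
Hypotheses (l4 : (l %% 4)%Z = 0) (l_ge : 20 <= l).
Hypotheses (stripS : forall t v : int, strip c c' l t v -> S t v) (closedG : knight_closed S G).

Let step (t v t' v' : int) : G t v -> strip c c' l t' v' ->
  (`|t' - t| == 1) && (`|v' - v| == 2) || (`|t' - t| == 2) && (`|v' - v| == 1) -> G t' v'.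
Proof. by move=> Gtv /stripS S' mv; apply: (closedG _ S' Gtv); rewrite movesE. Qed.

Let row (t v : int) : 6 <= t <= l - 6 -> 0 <= v <= 1 -> strip c c' l t v.
Proof. rewrite /strip; lia. Qed.

(** Each of the [k] moves along a zigzag, in direction [s], advances 2 columns and switches rows,
    hence the parity condition. *)
Let run (s : int) (k : nat) (t v v' : int) : `|s| = 1 -> G t v -> 6 <= t <= l - 6 ->
  6 <= t + 2 * s * k%:Z <= l - 6 -> 0 <= v <= 1 -> 0 <= v' <= 1 ->
  ((v' - v - k%:Z) %% 2)%Z = 0 -> G (t + 2 * s * k%:Z) v'.
Proof.
move=> s1; elim: k t v => [|k IH] t v Gtv ht ht' hv hv' par.
  by have -> : v' = v by [lia]; rewrite mulr0 addr0.
have -> : t + 2 * s * k.+1%:Z = t + 2 * s + 2 * s * k%:Z by lia.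
have ht2 : 6 <= t + 2 * s <= l - 6.
  have [ks|ks] : s = 1 \/ s = -1 by [lia].
    by subst s; lia.
  by subst s; lia.
apply: (IH _ (1 - v)); try lia.
by apply: (step Gtv); [apply: row; lia | lia].
Qed.

(* The zigzag through (t, v) is determined by t - 2v mod 4. *)
Let same_class (t v t' v' : int) : G t v -> 6 <= t <= l - 6 -> 0 <= v <= 1 ->
  6 <= t' <= l - 6 -> 0 <= v' <= 1 -> ((t' - 2 * v' - (t - 2 * v)) %% 4)%Z = 0 -> G t' v'.
Proof.
move=> Gtv ht hv ht' hv' cl; have [le|le] := leP t t'.
  have E : t' = t + 2 * 1 * `|((t' - t) %/ 2)%Z|%N%:Z by lia.
  by rewrite E; apply: (run (v := v)) => //; lia.
have E : t' = t + 2 * -1 * `|((t - t') %/ 2)%Z|%N%:Z by lia.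
by rewrite E; apply: (run (v := v)) => //; lia.
Qed.

(* The zigzags 0 and 3 come from the previous strip. The far end joins 3 to 2
   because 4 divides l, and the near end joins 2 to 1. *)
Lemma strip_reach : G 5 1 -> G 6 1 -> forall t v : int, strip c c' l t v -> G t v.
Proof.
move=> G51 G61.
have G70 : G 7 0 by apply: (step G51); [apply: row; lia | lia].
have G80 : G 8 0 by apply: (step G61); [apply: row; lia | lia].
have G3 : G (l - 7) 1 by apply: (same_class G70); lia.
have Gl2 : G (l - 5) 2 by apply: (step G3); [rewrite /strip; lia | lia].
have Gl0 : G (l - 6) 0 by apply: (step Gl2); [apply: row; lia | lia].
have G60 : G 6 0 by apply: (same_class Gl0); lia.
have G52 : G 5 2 by apply: (step G60); [rewrite /strip; lia | lia].
have G71 : G 7 1 by apply: (step G52); [apply: row; lia | lia].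
have Grow (t v : int) : 6 <= t <= l - 6 -> 0 <= v <= 1 -> G t v.
  move=> ht hv.
  have : ((t - 2 * v) %% 4)%Z = 0 \/ ((t - 2 * v) %% 4)%Z = 1 \/
         ((t - 2 * v) %% 4)%Z = 2 \/ ((t - 2 * v) %% 4)%Z = 3 by lia.
  case=> [h|[h|[h|h]]].
  - by apply: (same_class G80); lia.
  - by apply: (same_class G71); lia.
  - by apply: (same_class G60); lia.
  - by apply: (same_class G70); lia.
have Gl1 : G (l - 5) 1.
  by apply: (step (Grow (l - 7) 0 _ _)); try lia; rewrite /strip; lia.
move=> t v st.
have [/andP[]|out] := boolP ((6 <= t <= l - 6) && (0 <= v <= 1)); first exact: Grow.
have [|[|[|[|]]]] : (v = 1 /\ (t = 5 \/ t = l - 5)) \/ (v = 2 /\ (t = 5 \/ t = l - 5)) \/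
   (v = 2 /\ t = 4) \/ (v = 2 /\ t = l - 4) \/ (t = 3 \/ l - t = 3) /\ (v = 0 \/ v = 2).
  by move: st out; rewrite /strip; case: (c); case: (c'); lia.
- by case=> -> [] ->.
- by case=> -> [] ->.
- by case=> ? ?; apply: (step G61) => //; lia.
- by case=> ? ?; apply: (step (Grow (l - 6) 1 _ _)) => //; lia.
- by case=> -[] ? ?; [apply: (step G51) | apply: (step Gl1)] => //; lia.
Qed.

End StripReach.

Section SpiralReach.
Variables a n m : int.
Hypotheses (n1 : (n %% 4)%Z = 1) (m1 : (m %% 4)%Z = 1).
Hypotheses (a_gt0 : 0 < a) (n_ge : 8 * a + 17 <= n) (m_ge : 8 * a + 17 <= m).
Variable G : int -> int -> Prop.
Let S := spiral a n m.
Hypothesis closedG : knight_closed S G.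

Let step (x y x' y' : int) : G x y -> S x' y' ->
  (`|x' - x| == 1) && (`|y' - y| == 2) || (`|x' - x| == 2) && (`|y' - y| == 1) -> G x' y'.
Proof. by move=> Gxy S' mv; apply: (closedG _ S' Gxy); rewrite movesE. Qed.

Let southS (j t v : int) : 0 <= j < a -> strip (j == 0) false (n + 3 - 8 * j) t v ->
  S (t + 4 * j - 4) (v + 4 * j).
Proof.
move=> hj st; have vb : 0 <= v <= 2 by have /(_ ltac:(lia)) := strip_bound _ st; lia.
apply/orP; left; rewrite /south (_ : ((v + 4 * j) %/ 4)%Z = j); last by lia.
by rewrite hj; move: st; congr strip; lia.
Qed.

Let eastS (j t v : int) : 0 <= j < a -> strip false false (m - 1 - 8 * j) t v ->
  S (n - 1 - v - 4 * j) (t + 4 * j).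
Proof.
move=> hj st; have vb : 0 <= v <= 2 by have /(_ ltac:(lia)) := strip_bound _ st; lia.
apply/or4P; apply: Or42.
rewrite /east (_ : ((n - 1 - (n - 1 - v - 4 * j)) %/ 4)%Z = j); last by lia.
by rewrite hj; move: st; congr strip; lia.
Qed.

Let northS (j t v : int) : 0 <= j < a -> strip false false (n - 1 - 8 * j) t v ->
  S (n - 1 - t - 4 * j) (m - 1 - v - 4 * j).
Proof.
move=> hj st; have vb : 0 <= v <= 2 by have /(_ ltac:(lia)) := strip_bound _ st; lia.
apply/or4P; apply: Or43.
rewrite /north (_ : ((m - 1 - (m - 1 - v - 4 * j)) %/ 4)%Z = j); last by lia.
by rewrite hj; move: st; congr strip; lia.
Qed.

Let westS (j t v : int) : 0 <= j < a -> strip false (j == a - 1) (m - 5 - 8 * j) t v ->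
  S (v + 4 * j) (m - 1 - t - 4 * j).
Proof.
move=> hj st; have vb : 0 <= v <= 2 by have /(_ ltac:(lia)) := strip_bound _ st; lia.
apply/or4P; apply: Or44.
rewrite /west (_ : ((v + 4 * j) %/ 4)%Z = j); last by lia.
by rewrite hj; move: st; congr strip; lia.
Qed.

Let isom (X Y : int -> int -> int) : 
  (forall t v t' v' : int, (t' - t, v' - v) \in moves ->
      (X t' v' - X t v, Y t' v' - Y t v) \in moves) ->
  knight_closed (fun t v => S (X t v) (Y t v)) (fun t v => G (X t v) (Y t v)).
Proof. move=> XY t v t' v' mv; exact: (closedG (XY t v t' v' mv)). Qed.

(** The congruences on [n] and [m] make the lengths of all strips divisible by 4, and the bounds by
    [8 * a + 17] keep them at least 20, as [strip_reach] requires. *)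
Let good_south (j : int) : 0 <= j < a -> G (1 + 4 * j) (1 + 4 * j) -> G (2 + 4 * j) (1 + 4 * j) ->
  forall t v : int, strip (j == 0) false (n + 3 - 8 * j) t v -> G (t + 4 * j - 4) (v + 4 * j).
Proof.
move=> hj G5 G6; apply: (@strip_reach (fun t v => S (t + 4 * j - 4) (v + 4 * j))
  (fun t v => G (t + 4 * j - 4) (v + 4 * j))); try lia.
- by move=> t v; apply: southS.
- by apply: isom => t v t' v'; rewrite !movesE; lia.
- by move: G5; congr G; lia.
- by move: G6; congr G; lia.
Qed.

Let good_east (j : int) : 0 <= j < a -> G (n - 2 - 4 * j) (5 + 4 * j) -> G (n - 2 - 4 * j) (6 + 4 * j) ->
  forall t v : int, strip false false (m - 1 - 8 * j) t v -> G (n - 1 - v - 4 * j) (t + 4 * j).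
Proof.
move=> hj G5 G6; apply: (@strip_reach (fun t v => S (n - 1 - v - 4 * j) (t + 4 * j))
  (fun t v => G (n - 1 - v - 4 * j) (t + 4 * j))); try lia.
- by move=> t v; apply: eastS.
- by apply: isom => t v t' v'; rewrite !movesE; lia.
- by move: G5; congr G; lia.
- by move: G6; congr G; lia.
Qed.

Let good_north (j : int) : 0 <= j < a ->
  G (n - 6 - 4 * j) (m - 2 - 4 * j) -> G (n - 7 - 4 * j) (m - 2 - 4 * j) ->
  forall t v : int, strip false false (n - 1 - 8 * j) t v ->
    G (n - 1 - t - 4 * j) (m - 1 - v - 4 * j).
Proof.
move=> hj G5 G6; apply: (@strip_reach (fun t v => S (n - 1 - t - 4 * j) (m - 1 - v - 4 * j))
  (fun t v => G (n - 1 - t - 4 * j) (m - 1 - v - 4 * j))); try lia.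
- by move=> t v; apply: northS.
- by apply: isom => t v t' v'; rewrite !movesE; lia.
- by move: G5; congr G; lia.
- by move: G6; congr G; lia.
Qed.

Let good_west (j : int) : 0 <= j < a ->
  G (1 + 4 * j) (m - 6 - 4 * j) -> G (1 + 4 * j) (m - 7 - 4 * j) ->
  forall t v : int, strip false (j == a - 1) (m - 5 - 8 * j) t v ->
    G (v + 4 * j) (m - 1 - t - 4 * j).
Proof.
move=> hj G5 G6; apply: (@strip_reach (fun t v => S (v + 4 * j) (m - 1 - t - 4 * j))
  (fun t v => G (v + 4 * j) (m - 1 - t - 4 * j))); try lia.
- by move=> t v; apply: westS.
- by apply: isom => t v t' v'; rewrite !movesE; lia.
- by move: G5; congr G; lia.
- by move: G6; congr G; lia.
Qed.

Let good_ring (j : int) : 0 <= j < a -> G (1 + 4 * j) (1 + 4 * j) -> G (2 + 4 * j) (1 + 4 * j) ->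
  [/\ forall t v : int, strip (j == 0) false (n + 3 - 8 * j) t v -> G (t + 4 * j - 4) (v + 4 * j),
      forall t v : int, strip false false (m - 1 - 8 * j) t v -> G (n - 1 - v - 4 * j) (t + 4 * j),
      forall t v : int, strip false false (n - 1 - 8 * j) t v ->
        G (n - 1 - t - 4 * j) (m - 1 - v - 4 * j)
    & forall t v : int, strip false (j == a - 1) (m - 5 - 8 * j) t v ->
        G (v + 4 * j) (m - 1 - t - 4 * j)].
Proof.
move=> hj G5 G6; have gs := good_south hj G5 G6.
(* In strip coordinates the two passages round a corner are [(l - 4, 2)], [(3, 2)], [(5, 1)] and
   [(l - 3, 2)], [(4, 2)], [(6, 1)], the first cell being in the old strip. *)
have turn (x0 y0 x1 y1 x2 y2 : int) : G x0 y0 -> S x1 y1 -> S x2 y2 ->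
    (`|x1 - x0| == 1) && (`|y1 - y0| == 2) || (`|x1 - x0| == 2) && (`|y1 - y0| == 1) ->
    (`|x2 - x1| == 1) && (`|y2 - y1| == 2) || (`|x2 - x1| == 2) && (`|y2 - y1| == 1) ->
    G x2 y2.
  by move=> G0 S1 S2 m1' m2; apply: (step (step G0 S1 m1') S2 m2).
have st4 c c' l : strip c c' l 4 2 by [].
have st3 c' l : strip false c' l 3 2 by rewrite /strip /=; lia.
have st5 c c' (l : int) : 16 <= l -> strip c c' l 5 1 by rewrite /strip; lia.
have st6 c c' (l : int) : 16 <= l -> strip c c' l 6 1 by rewrite /strip; lia.
have sr3 c (l : int) : strip c false l (l - 3) 2 by rewrite /strip; lia.
have sr4 c c' (l : int) : strip c c' l (l - 4) 2 by rewrite /strip; lia.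
have ge : forall t v : int, strip false false (m - 1 - 8 * j) t v -> G (n - 1 - v - 4 * j) (t + 4 * j).
  apply: good_east => //.
  - have := turn _ _ _ _ _ _ (gs _ _ (sr4 _ _ _)) (eastS hj (st3 _ _)) (eastS hj (st5 _ _ _ _)).
    rewrite (_ : n - 1 - 1 - 4 * j = n - 2 - 4 * j); last by lia.
    by apply; lia.
  - have := turn _ _ _ _ _ _ (gs _ _ (sr3 _ _)) (eastS hj (st4 _ _ _)) (eastS hj (st6 _ _ _ _)).
    rewrite (_ : n - 1 - 1 - 4 * j = n - 2 - 4 * j); last by lia.
    by apply; lia.
have gn : forall t v : int, strip false false (n - 1 - 8 * j) t v ->
    G (n - 1 - t - 4 * j) (m - 1 - v - 4 * j).
  apply: good_north => //.
  - have := turn _ _ _ _ _ _ (ge _ _ (sr4 _ _ _)) (northS hj (st3 _ _)) (northS hj (st5 _ _ _ _)).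
    rewrite (_ : n - 1 - 5 - 4 * j = n - 6 - 4 * j); last by lia.
    rewrite (_ : m - 1 - 1 - 4 * j = m - 2 - 4 * j); last by lia.
    by apply; lia.
  - have := turn _ _ _ _ _ _ (ge _ _ (sr3 _ _)) (northS hj (st4 _ _ _)) (northS hj (st6 _ _ _ _)).
    rewrite (_ : n - 1 - 6 - 4 * j = n - 7 - 4 * j); last by lia.
    rewrite (_ : m - 1 - 1 - 4 * j = m - 2 - 4 * j); last by lia.
    by apply; lia.
split => //; apply: good_west => //.
- have := turn _ _ _ _ _ _ (gn _ _ (sr4 _ _ _)) (westS hj (st3 _ _)) (westS hj (st5 _ _ _ _)).
  rewrite (_ : m - 1 - 5 - 4 * j = m - 6 - 4 * j); last by lia.
  by apply; lia.
- have := turn _ _ _ _ _ _ (gn _ _ (sr3 _ _)) (westS hj (st4 _ _ _)) (westS hj (st6 _ _ _ _)).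
  rewrite (_ : m - 1 - 6 - 4 * j = m - 7 - 4 * j); last by lia.
  by apply; lia.
Qed.

Lemma spiral_reach : G 1 1 -> forall x y, spiral a n m x y -> G x y.
Proof.
move=> G11.
have start (k : nat) : k%:Z < a -> G (1 + 4 * k%:Z) (1 + 4 * k%:Z) /\ G (2 + 4 * k%:Z) (1 + 4 * k%:Z).
  elim: k => [|k IH] hk.
    rewrite mulr0 !addr0; split => //.
    (* At the closed beginning, the displaced cell [(3, 0)] of the first strip joins its two
       entrance zigzags. *)
    have s30 : S (-1) 0 by apply: (@southS 0 3 0); rewrite /strip /=; lia.
    have s42 : S 0 2 by apply: (@southS 0 4 2); rewrite /strip /=; lia.
    have s61 : S 2 1 by apply: (@southS 0 6 1); rewrite /strip /=; lia.
    exact: (step (step (step G11 s30 _) s42 _) s61 _).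
  have hj : 0 <= k%:Z < a by lia.
  have hj' : 0 <= k.+1%:Z < a by lia.
  have [G5 G6] := IH ltac:(lia); have [_ _ _ gw] := good_ring hj G5 G6.
  (* As [k + 1 < a], the west strip [k] is not the last one, so its far end is open. *)
  have w3 : strip false (k%:Z == a - 1) (m - 5 - 8 * k%:Z) (m - 5 - 8 * k%:Z - 3) 2.
    by rewrite (_ : (k%:Z == a - 1) = false) /strip; lia.
  have w4 : strip false (k%:Z == a - 1) (m - 5 - 8 * k%:Z) (m - 5 - 8 * k%:Z - 4) 2.
    by rewrite /strip; lia.
  have n0 : (k.+1%:Z == 0) = false by [].
  have s t v : strip false false (n + 3 - 8 * k.+1%:Z) t v ->
    S (t + 4 * k.+1%:Z - 4) (v + 4 * k.+1%:Z).
    by move=> st; apply: southS; rewrite ?n0.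
  have s3 := s 3 2 ltac:(by rewrite /strip /=; clear; lia).
  have s4 := s 4 2 ltac:(by rewrite /strip /=; clear; lia).
  have l_ge : 16 <= n + 3 - 8 * k.+1%:Z by lia.
  have s5 := s 5 1 ltac:(by move: l_ge; rewrite /strip; clear; lia).
  have s6 := s 6 1 ltac:(by move: l_ge; rewrite /strip; clear; lia).
  have := step (step (gw _ _ w4) s3 ltac:(clear; lia)) s5 ltac:(clear; lia).
  have := step (step (gw _ _ w3) s4 ltac:(clear; lia)) s6 ltac:(clear; lia).
  rewrite (_ : 6 + 4 * k.+1%:Z - 4 = 2 + 4 * k.+1%:Z); last by clear; lia.
  by rewrite (_ : 5 + 4 * k.+1%:Z - 4 = 1 + 4 * k.+1%:Z); last by clear; lia.
have ring (j : int) (hj : 0 <= j < a) :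
    G (1 + 4 * j) (1 + 4 * j) /\ G (2 + 4 * j) (1 + 4 * j).
  have ->: j = `|j|%N%:Z by lia.
  by apply: start; lia.
move=> x y /or4P[] /andP[hj st]; have [G5 G6] := ring _ hj;
  have [gs ge gn gw] := good_ring hj G5 G6.
- by move: (gs _ _ st); congr G; lia.
- by move: (ge _ _ st); congr G; lia.
- by move: (gn _ _ st); congr G; lia.
- by move: (gw _ _ st); congr G; lia.
Qed.

End SpiralReach.

(** * The spiral fills half of the board *)

Lemma card_knight_nbrs (m n : nat) (P : int -> int -> bool) (x : cell m n) :
  (forall i j : int, P i j -> (0 <= i < n) && (0 <= j < m)) ->
  #|[set y in [set y : cell m n | P y.1 y.2] | knight x y]| = deg P x.1 x.2.
Proof.
move=> Pb; set A := [set y in _ | _]; rewrite /deg -size_filter.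
rewrite cardE -(size_map (fun y => cell_coord y - cell_coord x)).
apply/perm_size/uniq_perm.
- by rewrite map_inj_uniq ?enum_uniq // => y z /addIr /cell_coord_inj.
- exact: filter_uniq.
move=> d; apply/mapP/idP => [[y]|].
  rewrite mem_enum !inE => /andP[Py xy] ->; rewrite mem_filter -knightE xy andbT /=.
  by rewrite !subrKC.
rewrite mem_filter => /andP[/= Pd dm]; have /andP[/andP[i0 iN] /andP[j0 jN]] := Pb _ _ Pd.
have hi : (absz (Posz x.1 + d.1)%R < n)%N by move: (Posz x.1 + d.1) i0 iN => z; lia.
have hj : (absz (Posz x.2 + d.2)%R < m)%N by move: (Posz x.2 + d.2) j0 jN => z; lia.
have dE : d = cell_coord (Ordinal hi, Ordinal hj) - cell_coord x.
  by rewrite /cell_coord /=; case: (d) i0 j0 => p q /= *; congr pair => /=; lia.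
exists (Ordinal hi, Ordinal hj) => //; rewrite mem_enum !inE knightE -dE dm andbT /=.
by rewrite !gez0_abs.
Qed.

Section SpiralBoard.
Variables (M N : nat) (a n m : int).
Hypotheses (n1 : (n %% 4)%Z = 1) (m1 : (m %% 4)%Z = 1).
Hypotheses (a_gt0 : 0 < a) (n_ge : 8 * a + 17 <= n) (m_ge : 8 * a + 17 <= m).
Hypotheses (nN : n + 4 <= N) (mM : m <= M).

(** The shift brings the leftmost possible column, [-4], onto the board. *)
Let P (x y : int) := spiral a n m (x - 4) y.
Definition spiral_set : {set cell M N} := [set c : cell M N | P c.1 c.2].

Let degP x y : deg P x y = deg (spiral a n m) (x - 4) y.
Proof. by apply: eq_deg => i j _; rewrite /P addrAC. Qed.

Let Pb x y : P x y -> (0 <= x < N) && (0 <= y < M).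
Proof. by move=> /spiral_bound; lia. Qed.

Let x0 : (5 < N)%N. Proof. lia. Qed.
Let y0 : (1 < M)%N. Proof. lia. Qed.
Let root : cell M N := (Ordinal x0, Ordinal y0).

Let root_in : root \in spiral_set.
Proof. by rewrite inE /P /spiral /south /strip /=; lia. Qed.

Let reach (A : {set cell M N}) : root \in A ->
  (forall x y, x \in A -> y \in spiral_set -> knight x y -> y \in A) -> spiral_set \subset A.
Proof.
move=> rA Acl; pose G (x y : int) := exists2 c : cell M N, c \in A & cell_coord c = (x + 4, y).
suff GA : forall x y, spiral a n m x y -> G x y.
  apply/subsetP => c; rewrite inE => /GA [c' c'A].
  by rewrite subrK => /cell_coord_inj <-.
apply: spiral_reach => //; last by exists root.
move=> x y x' y' mv Sxy [c cA cE].
have Pc : P (x' + 4) y' by rewrite /P addrK.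
have /andP[/andP[i0 iN] /andP[j0 jN]] := Pb Pc.
have hi : (absz (x' + 4)%R < N)%N by lia.
have hj : (absz y' < M)%N by lia.
have E : cell_coord (Ordinal hi, Ordinal hj) = (x' + 4, y') by rewrite /cell_coord /= !gez0_abs.
exists (Ordinal hi, Ordinal hj) => //; apply: (Acl c) => //.
  by rewrite inE /= !gez0_abs.
rewrite knightE E cE (_ : _ - _ = (x' - x, y' - y)) //.
by congr pair => /=; lia.
Qed.

Lemma spiral_snake_cycle : exists2 s : seq (cell M N), snake_cycle (@knight M N) s & size s = #|spiral_set|.
Proof.
apply: two_regular_snake_cycle; last by apply/set0Pn; exists root.
- exact: knight_sym.
- exact: knight_irr.
- move=> x xS; rewrite card_knight_nbrs // degP deg_spiral //.
  by move: xS; rewrite inE.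
move=> A AS /set0Pn[z zA] Acl; apply/eqP; rewrite eqEsubset AS /=.
case: (boolP (root \in A)) => [rA|rA]; first exact: reach.
(* By symmetry of the moves the complement of [A] is closed too; containing the root, it would be
   everything and [A] would be empty. *)
have : spiral_set \subset spiral_set :\: A.
  apply: reach; first by rewrite inE rA.
  move=> x y; rewrite !inE => /andP[xA xS] yS xy; rewrite yS andbT.
  apply: contra xA => yA; apply: Acl yA _ _; first by rewrite inE.
  by rewrite knight_sym.
by move/subsetP/(_ z (subsetP AS z zA)); rewrite inE zA.
Qed.

End SpiralBoard.

(** Bands of bounded width, straight or diagonal, will cover the cells outside the four regular
    regions at linear cost. *)
Lemma card_band_x M N (g : int -> int) (K : nat) :
  (#|[set c : cell M N | (g (Posz c.2) <= Posz c.1 < g (Posz c.2) + K)%R]| <= K * M)%N.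
Proof.
case: K => [|K].
  by rewrite eq_card0 // => c; rewrite !inE addr0; apply/negP => /andP[/le_lt_trans h /h]; rewrite ltxx.
rewrite -[X in (_ <= X * _)%N]card_ord -[X in (_ <= _ * X)%N]card_ord -card_prod.
pose h (c : cell M N) := (inord (absz (Posz c.1 - g (Posz c.2))%R) : 'I_K.+1, c.2).
have lt_z (u z : int) : z <= u < z + K.+1 -> (absz (u - z)%R < K.+1)%N by lia.
rewrite -(card_in_imset (f := h)) ?max_card // => -[x y] [x' y']; rewrite !inE /= => hx hx' [].
move=> /(congr1 (@nat_of_ord _)); rewrite !inordK ?lt_z // => E yy; subst y'.
by congr pair; apply: ord_inj; move: (g _) hx hx' E => z; lia.
Qed.

Lemma card_band_y M N (g : int -> int) (K : nat) :
  (#|[set c : cell M N | (g (Posz c.1) <= Posz c.2 < g (Posz c.1) + K)%R]| <= K * N)%N.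
Proof.
case: K => [|K].
  by rewrite eq_card0 // => c; rewrite !inE addr0; apply/negP => /andP[/le_lt_trans h /h]; rewrite ltxx.
rewrite mulnC -[X in (_ <= _ * X)%N]card_ord -[X in (_ <= X * _)%N]card_ord -card_prod.
pose h (c : cell M N) := (c.1, inord (absz (Posz c.2 - g (Posz c.1))%R) : 'I_K.+1).
have lt_z (u z : int) : z <= u < z + K.+1 -> (absz (u - z)%R < K.+1)%N by lia.
rewrite -(card_in_imset (f := h)) ?max_card // => -[x y] [x' y']; rewrite !inE /= => hy hy' [] xx.
subst x'; move=> /(congr1 (@nat_of_ord _)); rewrite !inordK ?lt_z // => E.
by congr pair; apply: ord_inj; move: (g _) hy hy' E => z; lia.
Qed.

Section Count.
Variables (M N : nat) (a n m : int).
Hypotheses (a_gt0 : 0 < a) (n_ge : 8 * a + 17 <= n) (m_ge : 8 * a + 17 <= m).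
Hypotheses (nN : N%:Z - 7 <= n <= N%:Z - 4) (mM : M%:Z - 3 <= m <= M%:Z).
Hypothesis a_max : (n <= 8 * a + 24) || (m <= 8 * a + 24).

(* Interiors of the four regions where the spiral consists of whole rows or
   columns. *)
Let zS (x y : int) := (0 <= y < 4 * a) && (y + 10 <= x) && (y + 10 <= n - 1 - x).
Let zE (x y : int) := (0 <= n - 1 - x < 4 * a) && (n - 1 - x + 10 <= y) && (n - 1 - x + 10 <= m - 1 - y).
Let zN (x y : int) := (0 <= m - 1 - y < 4 * a) && (m - 1 - y + 10 <= x) && (m - 1 - y + 10 <= n - 1 - x).
Let zW (x y : int) := (0 <= x < 4 * a) && (x + 10 <= y) && (x + 10 <= m - 1 - y).

Let zS_in x y : zS x y -> (y %% 4)%Z < 2 -> spiral a n m x y.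
Proof.
move=> z y2; apply/or4P; apply: Or41; rewrite /south; apply/andP; split.
  by move: z; rewrite /zS; lia.
by move: z; rewrite /zS /strip; lia.
Qed.

Let zE_in x y : zE x y -> ((n - 1 - x) %% 4)%Z < 2 -> spiral a n m x y.
Proof.
move=> z y2; apply/or4P; apply: Or42; rewrite /east; apply/andP; split.
  by move: z; rewrite /zE; lia.
by move: z; rewrite /zE /strip; lia.
Qed.

Let zN_in x y : zN x y -> ((m - 1 - y) %% 4)%Z < 2 -> spiral a n m x y.
Proof.
move=> z y2; apply/or4P; apply: Or43; rewrite /north; apply/andP; split.
  by move: z; rewrite /zN; lia.
by move: z; rewrite /zN /strip; lia.
Qed.

Let zW_in x y : zW x y -> (x %% 4)%Z < 2 -> spiral a n m x y.
Proof.
move=> z y2; apply/or4P; apply: Or44; rewrite /west; apply/andP; split.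
  by move: z; rewrite /zW; lia.
by move: z; rewrite /zW /strip; lia.
Qed.
Let zone (p : int * int) : bool := [|| zS p.1 p.2, zE p.1 p.2, zN p.1 p.2 | zW p.1 p.2].

Let shift (s : int) (p : int * int) : int * int :=
  if zS p.1 p.2 then (p.1, p.2 - s) else if zE p.1 p.2 then (p.1 + s, p.2)
  else if zN p.1 p.2 then (p.1, p.2 + s) else (p.1 - s, p.2).

(* Moving the cells missed by the spiral two steps outwards sends them
   injectively into the spiral. *)
Let zone_shift p : zone p -> ~~ spiral a n m p.1 p.2 ->
  spiral a n m (shift 2 p).1 (shift 2 p).2 /\ shift (-2) (shift 2 p) = p.
Proof.
case: p => x y; rewrite /zone /= => z sp.
have [s|s] := boolP (zS x y).
  have y2 : 2 <= (y %% 4)%Z by rewrite leNgt; apply: contra sp; exact: zS_in.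
  have s' : zS x (y - 2) by move: s; rewrite /zS; lia.
  have -> : shift 2 (x, y) = (x, y - 2) by rewrite /shift /= s.
  split; first by apply: zS_in => //=; move: y2; clear; lia.
  by rewrite /shift /= s'; congr pair; clear; lia.
have [e|e] := boolP (zE x y).
  have y2 : 2 <= ((n - 1 - x) %% 4)%Z by rewrite leNgt; apply: contra sp; exact: zE_in.
  have e' : zE (x + 2) y by move: e; rewrite /zE; lia.
  have s' : zS (x + 2) y = false by apply/negP; move: e'; rewrite /zE /zS; lia.
  have -> : shift 2 (x, y) = (x + 2, y) by rewrite /shift /= (negbTE s) e.
  split; first by apply: zE_in => //=; move: y2; clear; lia.
  by rewrite /shift /= s' e'; congr pair; clear; lia.
have [w|w] := boolP (zN x y).
  have y2 : 2 <= ((m - 1 - y) %% 4)%Z by rewrite leNgt; apply: contra sp; exact: zN_in.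
  have w' : zN x (y + 2) by move: w; rewrite /zN; lia.
  have s' : zS x (y + 2) = false by apply/negP; move: w'; rewrite /zN /zS; lia.
  have e' : zE x (y + 2) = false by apply/negP; move: w'; rewrite /zN /zE; lia.
  have -> : shift 2 (x, y) = (x, y + 2) by rewrite /shift /= (negbTE s) (negbTE e) w.
  split; first by apply: zN_in => //=; move: y2; clear; lia.
  by rewrite /shift /= s' e' w'; congr pair; clear; lia.
have v : zW x y by move: z; rewrite (negbTE s) (negbTE e) (negbTE w).
have y2 : 2 <= (x %% 4)%Z by rewrite leNgt; apply: contra sp; exact: zW_in.
have v' : zW (x - 2) y by move: v; rewrite /zW; lia.
have s' : zS (x - 2) y = false by apply/negP; move: v'; rewrite /zW /zS; lia.
have e' : zE (x - 2) y = false by apply/negP; move: v'; rewrite /zW /zE; lia.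
have w' : zN (x - 2) y = false by apply/negP; move: v'; rewrite /zN /zW; lia.
have -> : shift 2 (x, y) = (x - 2, y).
  by rewrite /shift /= (negbTE s) (negbTE e) (negbTE w).
split; first by apply: zW_in => //=; move: y2; clear; lia.
by rewrite /shift /= s' e' w'; congr pair; clear; lia.
Qed.

Let offset (c : cell M N) : int * int := (Posz c.1 - 4, Posz c.2).

Let offset_inj : injective offset.
Proof.
by move=> c c' [/addIr h1 h2]; apply: cell_coord_inj; rewrite /cell_coord h1 h2.
Qed.

Let Z := [set c | zone (offset c)].
Let S := spiral_set M N a n m.

Let card_zone : (#|Z :\: S| <= #|S|)%N.
Proof.
rewrite !cardE -(size_map offset (enum S)) -(size_map (fun c => shift 2 (offset c))).
apply: uniq_leq_size.
  rewrite map_inj_in_uniq ?enum_uniq // => c c'; rewrite !mem_enum !inE.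
  move=> /andP[sc zc] /andP[sc' zc'] /(congr1 (shift (-2))).
  have [_ ->] := zone_shift zc sc; have [_ ->] := zone_shift zc' sc'.
  exact: offset_inj.
move=> d /mapP[c]; rewrite mem_enum !inE => /andP[sc zc] ->.
have [sp _] := zone_shift zc sc; move: (shift 2 _) sp => [x y] /= sp.
have /andP[xb yb] := spiral_bound a_gt0 n_ge m_ge sp.
have hx : (absz (x + 4)%R < N)%N by move: xb nN; clear; lia.
have hy : (absz y < M)%N by move: yb mM; clear; lia.
have cE : offset (Ordinal hx, Ordinal hy) = (x, y).
  by rewrite /offset /=; congr pair; move: xb yb; clear; lia.
apply/mapP; exists (Ordinal hx, Ordinal hy) => //.
by rewrite mem_enum inE -[_ - 4]/(offset (Ordinal hx, Ordinal hy)).1 -[Posz (Ordinal hx, Ordinal hy).2]/(offset (Ordinal hx, Ordinal hy)).2 cE.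
Qed.

Let card_nonzone : (#|~: Z| <= 108 * M + 28 * N)%N.
Proof.
pose bx g K := [set c : cell M N | (g (Posz c.2) <= Posz c.1 < g (Posz c.2) + Posz K)%R].
pose byy g K := [set c : cell M N | (g (Posz c.1) <= Posz c.2 < g (Posz c.1) + Posz K)%R].
(* Side margins, four diagonals, the core and the top margin, in board coordinates. Width 19 covers
   the differences from -9 to 9; width 24 for the core, taken in columns or in rows, comes from
   [a_max]. *)
pose U := bx (fun=> 0) 4 :|: bx (fun=> n + 4) 4 :|: bx (fun y => y - 5) 19 :|:
  bx (fun y => m - 6 - y) 19 :|: bx (fun y => n - 6 - y) 19 :|: bx (fun y => n - m + y - 5) 19 :|:
  bx (fun=> 4 * a + 4) 24 :|: byy (fun=> m) 4 :|: byy (fun=> 4 * a) 24.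
have ZU : ~: Z \subset U.
  apply/subsetP => -[[x hx] [y hy]]; rewrite !inE /offset /zone /zS /zE /zN /zW /=.
  by move: hx hy nN mM a_max a_gt0 n_ge m_ge; clear; lia.
apply: leq_trans (subset_leq_card ZU) _.
have card_bx g K : (#|bx g K| <= K * M)%N by exact: card_band_x.
have card_by g K : (#|byy g K| <= K * N)%N by exact: card_band_y.
apply: leq_trans (_ : (4 * M + 4 * M + 19 * M + 19 * M + 19 * M + 19 * M + 24 * M + 4 * N + 24 * N <= _)%N).
  by do 8 (apply: leq_trans (leq_card_setU _ _) _; apply: leq_add => //).
lia.
Qed.

Lemma card_spiral_set : (N * M <= 2 * #|spiral_set M N a n m| + (108 * M + 28 * N))%N.
Proof.
have <- : #|cell M N| = (N * M)%N by rewrite card_prod !card_ord.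
have : (#|~: S| <= #|Z :\: S| + #|~: Z|)%N.
  apply: leq_trans (_ : #|(Z :\: S) :|: ~: Z| <= _)%N; last exact: leq_card_setU.
  by apply: subset_leq_card; apply/subsetP => c; rewrite in_setU in_setD !in_setC => ->; case: (c \in Z).
have := card_zone; have := card_nonzone; have := cardsC S; rewrite -/S; lia.
Qed.

End Count.

Lemma snake_cycle_lower (m n : nat) : (40 <= m)%N -> (40 <= n)%N ->
  exists2 s : seq (cell m n), snake_cycle (@knight m n) s &
    (n * m <= 2 * size s + 108 * (m + n))%N.
Proof.
move=> hm hn.
(* The largest values congruent to 1 modulo 4 below [n - 4] and [m], inclusive, then the largest
   admissible number of turns; sides of at least 40 make it positive. *)
pose n' := (n - 4 - (n - 5) %% 4)%N; pose m' := (m - (m - 1) %% 4)%N.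
pose a := ((minn n' m' - 17) %/ 8)%N.
have [s cs szs] := @spiral_snake_cycle m n a n' m' ltac:(lia) ltac:(lia) ltac:(lia) ltac:(lia)
  ltac:(lia) ltac:(lia) ltac:(lia).
exists s => //; rewrite szs.
have := @card_spiral_set m n a n' m' ltac:(lia) ltac:(lia) ltac:(lia) ltac:(lia) ltac:(lia) ltac:(lia).
lia.
Qed.

(** * Bounds for the maximal lengths *)

Lemma leq_longest_snake_cycle (T : finType) (e : rel T) s :
  snake_cycle e s -> (size s <= longest_snake_cycle e)%N.
Proof.
move=> cs; have us : uniq s by case/and3P: cs => _ /andP[].
have lt_s : (size s < #|T|.+1)%N by rewrite ltnS -(card_uniqP us) max_card.
apply: (@leq_bigmax_cond _ _ (fun k : 'I_#|T|.+1 => k : nat) (Ordinal lt_s)).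
by apply/existsP; exists (in_tuple s).
Qed.

Lemma leq_longest_snake_path (T : finType) (e : rel T) s :
  snake_path e s -> ((size s).-1 <= longest_snake_path e)%N.
Proof.
move=> ps; have us : uniq s by case/and4P: ps.
have lt_s : (size s < #|T|.+1)%N by rewrite ltnS -(card_uniqP us) max_card.
apply: (@leq_bigmax_cond _ _ (fun k : 'I_#|T|.+1 => k.-1) (Ordinal lt_s)).
by apply/existsP; exists (in_tuple s).
Qed.

Lemma longest_snake_path_upper m n :
  (longest_snake_path (@knight m n) <= ((n + 16) * (m + 16)) %/ 2)%N.
Proof.
apply/bigmax_leqP => k /existsP[s /snake_path_upper]; rewrite size_tuple => sz.
by rewrite leq_divRL // mulnC (leq_trans _ sz) // leq_mul2l leq_pred.
Qed.

(** The extra 1 is the vertex deleted to open the cycle. *)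
Lemma longest_snake_cycle_upper m n :
  (longest_snake_cycle (@knight m n) <= (((n + 16) * (m + 16)) %/ 2).+1)%N.
Proof.
apply/bigmax_leqP => k /existsP[s /snake_cycle_path[p /snake_path_upper sz]].
by rewrite size_tuple => <-; rewrite ltnS leq_divRL // mulnC.
Qed.

Lemma dist_half_le (L q B : nat) : (2 * L <= q + 2 * B)%N -> (q <= 2 * L + 2 * B)%N ->
  `|L%:R - q%:R / 2%:R| <= B%:R :> rat.
Proof.
rewrite -!(ler_nat rat) [(q + _)%:R]natrD [(2 * L + _)%:R]natrD !natrM => h1 h2.
by rewrite ler_norml; apply/andP; split; lra.
Qed.

Theorem theorem3 :
  exists C : rat, forall m n : nat, (0 < m)%N -> (0 < n)%N ->
    `|(longest_snake_path (@knight m n))%:R - (m * n)%:R / 2%:R| <= C * (m + n)%:R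
    /\
    `|(longest_snake_cycle (@knight m n))%:R - (m * n)%:R / 2%:R| <= C * (m + n)%:R.
Proof.
(* A generous constant: the errors are at most [8 (m + n) + 129] above and [54 (m + n) + 2]
   below. *)
exists 200%:R => m n m_gt0 n_gt0.
have pu := longest_snake_path_upper m n; have cu := longest_snake_cycle_upper m n.
(* A cycle of length [k] yields a path with [k - 1] vertices and [k - 2] edges, whence the extra 4
   after doubling. *)
have [cl pl] : (m * n <= 2 * longest_snake_cycle (@knight m n) + 108 * (m + n))%N /\
    (m * n <= 2 * longest_snake_path (@knight m n) + 108 * (m + n) + 4)%N.
  (* On a board with a side below 40, the area itself is at most [108 (m + n)]. *)
  have [lt_m|ge_m] := ltnP m 40; first by split; nia.
  have [lt_n|ge_n] := ltnP n 40; first by split; nia.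
  have [s cs szs] := snake_cycle_lower ge_m ge_n.
  have := leq_longest_snake_cycle cs.
  have [p /leq_longest_snake_path] := snake_cycle_path cs.
  lia.
by split; rewrite -natrM; apply: dist_half_le; lia.
Qed.
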